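(* Let $\Lambda$ be a row-finite, source-free $k$-graph with finitely many vertices, and let $\pi:F(\mathcal{G}_\Lambda)\to[[\mathcal{G}_\Lambda]]$, $U\mapsto\pi_U$, be the canonical epimorphism. Then $$\ker\pi=\left\{\bigsqcup_{i=1}^n Z(\alpha_i,\beta_i)\in F(\mathcal{G}_\Lambda):\ \alpha_i\sim\beta_i\text{ for all }1\le i\le n\right\}.$$
   Context: **$k$-graphs.** $\mathbb{N}$ includes $0$ and $k\ge 1$. A $k$-graph is a countable small category $\Lambda$ with a functor $d:\Lambda\to\mathbb{N}^k$ such that whenever $d(\mu)=n+m$ there are unique $\alpha,\beta\in\Lambda$ with $\mu=\alpha\beta$, $d(\alpha)=n$, $d(\beta)=m$, $s(\alpha)=r(\beta)$ (products $\mu\nu$ are defined when $s(\mu)=r(\nu)$). $\Lambda^n:=d^{-1}(n)$; $\Lambda^0$ is the set of vertices; $v\Lambda^n:=\{\mu\in\Lambda^n: r(\mu)=v\}$. $\Lambda$ is row-finite if all $|v\Lambda^n|<\infty$, and source-free if all $v\Lambda^n\neq\varnothing$. **Infinite paths.** $\Omega_k:=\{(p,q)\in\mathbb{N}^k\times\mathbb{N}^k: p\le q\}$ is a $k$-graph with $(p,q)(q,m)=(p,m)$, $r(p,q)=(p,p)$, $s(p,q)=(q,q)$, $d(p,q)=q-p$. $\Lambda^\infty$ is the set of degree-preserving functors $x:\Omega_k\to\Lambda$; $v\Lambda^\infty:=\{x\in\Lambda^\infty:x(0,0)=v\}$. If $s(\mu)=x(0,0)$, $\mu x$ is the infinite path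 obtained by prefixing $\mu$ to $x$. $Z(\mu):=\{\mu x: x\in s(\mu)\Lambda^\infty\}$, and the sets $Z(\mu)$ form a basis of the topology of $\Lambda^\infty$. **Equivalence of paths.** $\mu\sim\nu$ in $\Lambda$ means $s(\mu)=s(\nu)$ and $\mu x=\nu x$ for all $x\in s(\mu)\Lambda^\infty$. **The groupoid.** $\mathcal{G}_\Lambda:=\{(\mu x,d(\mu)-d(\nu),\nu x)\in\Lambda^\infty\times\mathbb{Z}^k\times\Lambda^\infty: s(\mu)=s(\nu),\ x\in s(\mu)\Lambda^\infty\}$, with $r(x,n,y)=x$, $s(x,n,y)=y$, $(x,n,y)(y,m,z)=(x,n+m,z)$, $(x,n,y)^{-1}=(y,-n,x)$, unit space identified with $\Lambda^\infty$, and topology with basis the sets $Z(\mu,\nu):=\{(\mu x,d(\mu)-d(\nu),\nu x): x\in s(\mu)\Lambda^\infty\}$ with $s(\mu)=s(\nu)$. A bisection is a subset $U$ on which $r$ and $s$ are injective; it is full if $s(U)=r(U)=\Lambda^\infty$. $F(\mathcal{G}_\Lambda)$ is the group of full compact open bisections of $\mathcal{G}_\Lambda$ under $UV=\{\gamma\omega:\gamma\in U,\omega\in V,s(\gamma)=r(\omega)\}$. Each of its elements has the form $\bigsqcup_{i=1}^nZ(\alpha_i,\beta_i)$ with $s(\alpha_i)=s(\beta_i)$ and $\bigsqcup_i Z(\alpha_i)=\Lambda^\infty=\bigsqcup_i Z(\beta_i)$. For such $U$, $\pi_U:=r\circ(s|_U)^{-1}$ is a homeomorphism of $\Lambda^\infty$,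 and $[[\mathcal{G}_\Lambda]]:=\{\pi_U:U\in F(\mathcal{G}_\Lambda)\}$, a group under composition. *)

(* Defs.v *)
From HB Require Import structures.
From mathcomp Require Import all_boot all_order all_algebra.
From mathcomp Require Import boolp classical_sets functions cardinality filter.
From mathcomp Require Import topology.

Set Implicit Arguments.
Unset Strict Implicit.
Unset Printing Implicit Defensive.

Import GRing.Theory.

Local Open Scope classical_set_scope.

Notation "''N^' k" := {ffun 'I_k -> nat} (at level 8, k at level 2).
Notation "''Z^' k" := {ffun 'I_k -> int} (at level 8, k at level 2).

Definition lek k (p q : 'N^k) : bool := [forall i, (p i <= q i)%N].
Definition subk k (p q : 'N^k) : 'N^k := [ffun i => (p i - q i)%N].
Definition maxk k (p q : 'N^k) : 'N^k := [ffun i => maxn (p i) (q i)].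
Definition zdiff k (p q : 'N^k) : 'Z^k :=
  [ffun i => ((p i)%:Z - (q i)%:Z)%R].

Lemma lekP k (p q : 'N^k) : reflect (forall i, (p i <= q i)%N) (lek p q).
Proof. exact: forallP. Qed.

Lemma lekk k (p : 'N^k) : lek p p.
Proof. by apply/lekP. Qed.

Lemma lek_trans k (q p r : 'N^k) : lek p q -> lek q r -> lek p r.
Proof.
move=> /lekP pq /lekP qr; apply/lekP => i; exact: leq_trans (pq i) (qr i).
Qed.

Lemma subkK k (p q : 'N^k) : lek p q -> (p + subk q p)%R = q.
Proof. by move=> /lekP h; apply/ffunP => i; rewrite !ffunE; exact: subnKC. Qed.

Lemma lek_addr k (p n : 'N^k) : lek p (p + n)%R.
Proof. by apply/lekP => i; rewrite !ffunE leq_addr. Qed.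

Lemma addKk k (p n : 'N^k) : subk (p + n)%R p = n.
Proof. by apply/ffunP => i; rewrite !ffunE; exact: addKn. Qed.

Lemma addkI k (p : 'N^k) : injective (fun n => p + n)%R.
Proof. by move=> m n e; rewrite -(addKk p m) e addKk. Qed.

Lemma subkk k (p : 'N^k) : subk p p = 0%R.
Proof. by apply/ffunP => i; rewrite !ffunE subnn. Qed.

Lemma lek_maxl k (p q : 'N^k) : lek p (maxk p q).
Proof. by apply/lekP => i; rewrite !ffunE leq_maxl. Qed.

Lemma lek_maxr k (p q : 'N^k) : lek q (maxk p q).
Proof. by apply/lekP => i; rewrite !ffunE leq_maxr. Qed.

Lemma subk_add k (p q r : 'N^k) : lek p q -> lek q r ->
  (subk q p + subk r q)%R = subk r p.
Proof.
move=> pq qr; apply: (@addkI _ p).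
by rewrite /= addrA !subkK //; exact: lek_trans qr.
Qed.

Lemma lek_sub k (p q : 'N^k) : lek (subk p q) p.
Proof. by apply/lekP => i; rewrite !ffunE leq_subr. Qed.

Lemma zdiff_add k (a b c : 'N^k) :
  (zdiff a b + zdiff b c)%R = zdiff a c.
Proof. by apply/ffunP => i; rewrite !ffunE addrA subrK. Qed.

Lemma zdiffD k (a b c : 'N^k) : zdiff (a + c)%R (b + c)%R = zdiff a b.
Proof. by apply/ffunP => i; rewrite !ffunE !PoszD opprD addrACA subrr addr0. Qed.

Lemma zdiffN k (a b : 'N^k) : (- zdiff a b)%R = zdiff b a.
Proof. by apply/ffunP => i; rewrite !ffunE opprB. Qed.

Lemma zdiffkk k (a : 'N^k) : zdiff a a = 0%R.
Proof. by apply/ffunP => i; rewrite !ffunE subrr. Qed.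

Lemma zdiffDI k (a b c d : 'N^k) : zdiff a b = zdiff c d ->
  forall e f, (a + e = c + f)%R -> (b + e = d + f)%R.
Proof.
move=> /ffunP z e f /ffunP h; apply/ffunP => i.
move: (z i) (h i); rewrite !ffunE => zi hi.
apply/eqP; rewrite -eqz_nat; apply/eqP.
have {}hi : ((a i)%:Z + (e i)%:Z = (c i)%:Z + (f i)%:Z)%R.
  by rewrite -!PoszD; congr Posz.
suff : ((b i)%:Z + (e i)%:Z = (d i)%:Z + (f i)%:Z)%R by rewrite -!PoszD.
have -> : ((b i)%:Z = (a i)%:Z - ((a i)%:Z - (b i)%:Z))%R by rewrite subKr.
have -> : ((d i)%:Z = (c i)%:Z - ((c i)%:Z - (d i)%:Z))%R by rewrite subKr.
by rewrite zi addrAC hi addrAC.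
Qed.

(* Small categories are presented by their morphisms only: objects are
   identified with identity morphisms, so [krange] and [ksource] are valued in
   morphisms.  [kcomp a b] is meaningful only when [ksource a = krange b]; its
   other values are junk on which no axiom depends. *)
Record kgraph (k : nat) := KGraph {
  kmor :> Type;
  krange : kmor -> kmor;
  ksource : kmor -> kmor;
  kcomp : kmor -> kmor -> kmor;
  kdeg : kmor -> 'N^k;
  kmor_countable : countable [set: kmor];
  krange_source : forall a, krange (ksource a) = ksource a;
  ksource_range : forall a, ksource (krange a) = krange a;
  krange_comp : forall a b, ksource a = krange b ->
    krange (kcomp a b) = krange a;
  ksource_comp : forall a b, ksource a = krange b ->
    ksource (kcomp a b) = ksource b;
  kcompA : forall a b c, ksource a = krange b -> ksource b = krange c ->
    kcomp a (kcomp b c) = kcomp (kcomp a b) c;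
  krange_id : forall a, kcomp (krange a) a = a;
  ksource_id : forall a, kcomp a (ksource a) = a;
  kdeg_range : forall a, kdeg (krange a) = 0%R;
  kdeg_comp : forall a b, ksource a = krange b ->
    kdeg (kcomp a b) = (kdeg a + kdeg b)%R;
  kfactorization : forall c (n m : 'N^k), kdeg c = (n + m)%R ->
    exists! ab : kmor * kmor, [/\ c = kcomp ab.1 ab.2, kdeg ab.1 = n,
      kdeg ab.2 = m & ksource ab.1 = krange ab.2]
}.

Arguments krange {k _} _.
Arguments ksource {k _} _.
Arguments kcomp {k _} _ _.
Arguments kdeg {k _} _.
Arguments kmor {k} _.

Notation "a ** b" := (kcomp a b) (at level 40, left associativity).

Section KGraph.
Variables (k : nat) (L : kgraph k).
Implicit Types (a b c d v : L) (n m : 'N^k).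

(* [klevel n] is the set of paths of degree n; [klevel 0] is the set of
   vertices, i.e. of identity morphisms. *)
Definition klevel n : set L := [set a | kdeg a = n].
Definition kfrom (v : L) n : set L := [set a | krange a = v /\ kdeg a = n].

Definition row_finite := forall v n, klevel 0%R v -> finite_set (kfrom v n).
Definition source_free := forall v n, klevel 0%R v -> kfrom v n !=set0.
Definition finitely_many_vertices := finite_set (klevel 0%R).

Lemma krange_range a : krange (krange a) = krange a.
Proof. by rewrite -{1}(ksource_range a) krange_source ksource_range. Qed.

Lemma ksource_source a : ksource (ksource a) = ksource a.
Proof. by rewrite -{1}(krange_source a) ksource_range krange_source. Qed.

Lemma kdeg_source a : kdeg (ksource a) = 0%R.
Proof. by rewrite -krange_source kdeg_range. Qed.

Lemma kfact c n m : kdeg c = (n + m)%R -> exists a b,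
  [/\ c = a ** b, kdeg a = n, kdeg b = m & ksource a = krange b].
Proof. by move=> /kfactorization[[a b] [h _]]; exists a, b. Qed.

Lemma kfact_inj a b c d : ksource a = krange b -> ksource c = krange d ->
  kdeg a = kdeg c -> a ** b = c ** d -> a = c /\ b = d.
Proof.
move=> ab cd dac e.
have [x [_ xu]] := kfactorization (kdeg_comp ab).
have h1 := xu (a, b) (And4 erefl erefl erefl ab).
have dbd : kdeg d = kdeg b.
  apply: (@addkI _ (kdeg a)).
  by rewrite /= {1}dac -(kdeg_comp ab) -(kdeg_comp cd) e.
have h2 := xu (c, d) (And4 e (esym dac) dbd cd).
by move: h2; rewrite h1 => -[-> ->].
Qed.

Lemma kcompI a b c : ksource a = krange b -> ksource a = krange c ->
  a ** b = a ** c -> b = c.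
Proof. by move=> ab ac /(kfact_inj ab ac erefl)[]. Qed.

Lemma vertex_eq v : kdeg v = 0%R -> krange v = v /\ ksource v = v.
Proof.
move=> v0.
have e : krange v ** v = v ** ksource v by rewrite krange_id ksource_id.
have [] := kfact_inj _ _ _ e; rewrite ?ksource_range ?krange_source//.
by rewrite kdeg_range v0.
Qed.

End KGraph.

Section Omega.
Variable k : nat.

Definition omega_mor := {pq : 'N^k * 'N^k | lek pq.1 pq.2}.

Definition oid (p : 'N^k) : omega_mor := exist _ (p, p) (lekk p).

Definition orange (a : omega_mor) : omega_mor := oid (val a).1.
Definition osource (a : omega_mor) : omega_mor := oid (val a).2.
Definition odeg (a : omega_mor) : 'N^k := subk (val a).2 (val a).1.
(* (p, q)(p', m) := (p, m), with a junk value unless p <= m *)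
Definition ocomp (a b : omega_mor) : omega_mor :=
  insubd a ((val a).1, (val b).2).

Lemma oeqP (a b : omega_mor) :
  (val a).1 = (val b).1 -> (val a).2 = (val b).2 -> a = b.
Proof.
by move=> e1 e2; apply: val_inj; rewrite [LHS]surjective_pairing e1 e2 -surjective_pairing.
Qed.

Lemma oid_inj p q : oid p = oid q -> p = q.
Proof. by move=> /(congr1 val)/= []. Qed.

Lemma ocompE a b : osource a = orange b ->
  val (ocomp a b) = ((val a).1, (val b).2).
Proof.
move=> /oid_inj h; rewrite val_insubd /= ifT //.
by apply: lek_trans (valP a) _; rewrite h; exact: (valP b).
Qed.

Lemma omega_countable : countable [set: omega_mor].
Proof. exact: countableP. Qed.

Lemma ofact c (n m : 'N^k) : odeg c = (n + m)%R ->
  exists! ab : omega_mor * omega_mor, [/\ c = ocomp ab.1 ab.2, odeg ab.1 = n,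
      odeg ab.2 = m & osource ab.1 = orange ab.2].
Proof.
case: c => -[p q] /= pq; rewrite /odeg /= => e.
have qE : q = (p + n + m)%R by rewrite -addrA -e subkK.
pose a : omega_mor := exist _ (p, p + n)%R (lek_addr p n).
have h : lek (p + n)%R q by rewrite qE lek_addr.
pose b : omega_mor := exist _ (p + n, q)%R h.
have ab : osource a = orange b by exact: oeqP.
exists (a, b); split => /=.
  split; [by apply: val_inj; rewrite ocompE| |by rewrite qE addKk|exact: ab].
  exact: addKk.
move=> [[[p1 q1] h1] [[p2 q2] h2]] /= [/(congr1 val) cE d1 d2 ab'].
move: cE; rewrite ocompE//= => -[ep eq]; move/oid_inj: ab' => /= eq1.
rewrite /odeg /= in d1 d2; congr pair; apply: oeqP => //=.
- by rewrite ep -d1 subkK.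
- by rewrite -eq1 ep -d1 subkK.
Qed.

Lemma oA a b c : osource a = orange b -> osource b = orange c ->
  ocomp a (ocomp b c) = ocomp (ocomp a b) c.
Proof.
move=> ab bc; apply: val_inj; rewrite !ocompE//.
- by move/oid_inj: bc => bc; apply: oeqP; rewrite /= ocompE//= ?bc.
- by move/oid_inj: ab => ab; apply: oeqP; rewrite /= ocompE//= ?ab.
Qed.

Lemma odeg_comp a b : osource a = orange b ->
  odeg (ocomp a b) = (odeg a + odeg b)%R.
Proof.
move=> ab; rewrite /odeg ocompE//= -(@subk_add _ _ (val a).2) ?(valP a)//.
  by move/oid_inj: ab => ->.
by move/oid_inj: ab => ->; exact: (valP b).
Qed.

Definition Omega : kgraph k.
Proof.
refine (@KGraph k omega_mor orange osource ocomp odeg omega_countable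
  _ _ _ _ oA _ _ _ odeg_comp ofact).
- by [].
- by [].
- by move=> a b ab; rewrite /orange ocompE.
- by move=> a b ab; rewrite /osource ocompE.
- by move=> a; apply: val_inj; rewrite ocompE//= -surjective_pairing.
- by move=> a; apply: val_inj; rewrite ocompE//= -surjective_pairing.
- by move=> a; rewrite /odeg /= subkk.
Defined.

Definition oarr (p n : 'N^k) : Omega := exist _ (p, p + n)%R (lek_addr p n).

End Omega.

Arguments oarr {k} (_ _)%_R.

Record infpath (k : nat) (L : kgraph k) := InfPath {
  ip_fun :> Omega k -> L;
  ip_range : forall a, ip_fun (krange a) = krange (ip_fun a);
  ip_source : forall a, ip_fun (ksource a) = ksource (ip_fun a);
  ip_comp : forall a b, ksource a = krange b ->
    ip_fun (a ** b) = ip_fun a ** ip_fun b;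
  ip_deg : forall a, kdeg (ip_fun a) = kdeg a
}.

HB.instance Definition _ k (L : kgraph k) := gen_eqMixin (infpath L).
HB.instance Definition _ k (L : kgraph k) := gen_choiceMixin (infpath L).

Section InfPath.
Variables (k : nat) (L : kgraph k).
Implicit Types (a b c d : L) (n m p q : 'N^k) (x y z : infpath L).

(* ip_start x = x(0, 0), and [oarr p n] is the morphism (p, p + n) of Omega *)
Definition ip_start x : L := x (oarr 0 0).
Definition ip_from (v : L) : set (infpath L) := [set x | ip_start x = v].

(* y = a x, spelled out: y(0, d(a)) = a and
   y(d(a) + p, d(a) + p + n) = x(p, p + n) *)
Definition is_prefixed a x y : Prop :=
  y (oarr 0 (kdeg a)) = a /\
  forall p n, y (oarr (kdeg a + p)%R n) = x (oarr p n).

(* Junk value x unless ksource a = ip_start x; see [pcompP]. *)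
Definition pcomp a x : infpath L := xget x [set y | is_prefixed a x y].

Lemma ip_eq x y : (forall a : Omega k, x a = y a) -> x = y.
Proof.
case: x y => [f fr fs fc fd] [g gr gs gc gd] /= /funext e.
by rewrite -e in gr gs gc gd *; congr InfPath; exact: Prop_irrelevance.
Qed.

Lemma oarrE (a : Omega k) : a = oarr (val a).1 (odeg a).
Proof.
by apply: oeqP => //=; rewrite /odeg subkK //; exact: (valP a).
Qed.

Lemma oarr_st p n m : ksource (oarr p n) = krange (oarr (p + n)%R m) :> Omega k.
Proof. by []. Qed.

Lemma oarr_comp p n m : oarr p n ** oarr (p + n)%R m = oarr p (n + m)%R.
Proof.
by apply: oeqP => /=; rewrite ocompE//= addrA.
Qed.

Lemma oarr_deg p n : kdeg (oarr p n : Omega k) = n.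
Proof. exact: addKk. Qed.

Lemma oarr_range p n : krange (oarr p n) = oarr p 0 :> Omega k.
Proof. by apply: oeqP => //=; rewrite addr0. Qed.

Lemma oarr_src p n : ksource (oarr p n) = oarr (p + n)%R 0 :> Omega k.
Proof. by apply: oeqP => //=; rewrite addr0. Qed.

Lemma ip_st x p n m : ksource (x (oarr p n)) = krange (x (oarr (p + n)%R m)).
Proof. by rewrite -ip_source (oarr_st _ _ m) ip_range. Qed.

Lemma ip_st0 x n m : ksource (x (oarr 0 n)) = krange (x (oarr n m)).
Proof. by have := ip_st x 0%R n m; rewrite add0r. Qed.

Lemma ip_cat x p n m :
  x (oarr p (n + m)%R) = x (oarr p n) ** x (oarr (p + n)%R m).
Proof. by rewrite -ip_comp// oarr_comp. Qed.

Lemma ip_d x p n : kdeg (x (oarr p n)) = n.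
Proof. by rewrite ip_deg oarr_deg. Qed.

Lemma ip_r x n : krange (x (oarr 0 n)) = ip_start x.
Proof. by rewrite -ip_range oarr_range. Qed.

Lemma ip_eq0 x y m : (forall n, x (oarr 0 (m + n)%R) = y (oarr 0 (m + n)%R)) ->
  x = y.
Proof.
move=> h; have h0 n : x (oarr 0 n) = y (oarr 0 n).
  have := h n; rewrite addrC !ip_cat => /kfact_inj[]//; try exact: ip_st.
  by rewrite !ip_d.
apply: ip_eq => a; rewrite (oarrE a); move: (val a).1 (odeg a) => p n.
have := h0 (p + n)%R; rewrite !ip_cat h0 add0r => /kcompI; apply.
  by rewrite -h0; exact: ip_st0.
exact: ip_st0.
Qed.

(* a coherent family of finite paths determines an infinite path *)
Lemma ip_build (f : 'N^k -> L) :
  (forall n, kdeg (f n) = n) ->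
  (forall n m, exists2 b, ksource (f n) = krange b & f (n + m)%R = f n ** b) ->
  exists x, forall n, x (oarr 0 n) = f n.
Proof.
move=> fd fh.
have [g gP] : {g : Omega k -> L & forall a : Omega k,
    ksource (f (val a).1) = krange (g a) /\ f (val a).2 = f (val a).1 ** g a}.
  apply: (@choice _ _ (fun (a : Omega k) b => ksource (f (val a).1) = krange b
    /\ f (val a).2 = f (val a).1 ** b)) => a.
  have [b ? e] := fh (val a).1 (subk (val a).2 (val a).1).
  by exists b; rewrite -e subkK//; exact: (valP a).
have gI (a : Omega k) b : ksource (f (val a).1) = krange b ->
    f (val a).2 = f (val a).1 ** b -> g a = b.
  by move=> h e; have [h' e'] := gP a; apply: (kcompI h' h); rewrite -e -e'.
have gs (a : Omega k) : ksource (g a) = ksource (f (val a).2).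
  by have [h ->] := gP a; rewrite ksource_comp.
have idg p : g (oid p) = ksource (f p).
  by apply: gI => /=; rewrite ?krange_source ?ksource_id.
have gr (a : Omega k) : g (krange a) = krange (g a).
  by rewrite [LHS]idg; have [] := gP a.
have gss (a : Omega k) : g (ksource a) = ksource (g a) by rewrite [LHS]idg gs.
have gc (a b : Omega k) : ksource a = krange b -> g (a ** b) = g a ** g b.
  move=> ab; have gab : ksource (g a) = krange (g b) by rewrite -gss ab gr.
  have [ha ea] := gP a; have [hb eb] := gP b.
  move: (oid_inj ab) => /= abp.
  apply: gI; rewrite ocompE//=; first by rewrite krange_comp.
  by rewrite kcompA// -ea eb abp.
have gd (a : Omega k) : kdeg (g a) = kdeg a.
  have [ha ea] := gP a; apply: (@addkI _ (val a).1) => /=.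
  by rewrite -[in LHS](fd (val a).1) -kdeg_comp// -ea fd subkK//; exact: (valP a).
exists (InfPath gr gss gc gd) => n /=; apply: gI => /=.
  have [b hb] := fh 0%R n; rewrite add0r => ->; rewrite krange_comp//.
  by have [_ ->] := vertex_eq (fd 0%R); have [-> _] := vertex_eq (fd 0%R).
have [b hb] := fh 0%R n; rewrite !add0r => e.
have [e1 e2] := vertex_eq (fd 0%R).
have e3 : f 0%R = krange (f n) by rewrite e krange_comp.
by rewrite e3 krange_id.
Qed.

Lemma is_prefixedP a x y : ksource a = ip_start x ->
  is_prefixed a x y <-> forall n, y (oarr 0 (kdeg a + n)%R) = a ** x (oarr 0 n).
Proof.
move=> ax; split=> [[h0 h] n|h].
  by rewrite ip_cat h0; congr kcomp; rewrite add0r -h addr0.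
have h0 : y (oarr 0 (kdeg a)) = a.
  by have := h 0%R; rewrite addr0 => ->; rewrite -[x _]ax ksource_id.
split=> // p n; have := h (p + n)%R.
rewrite addrA (ip_cat y) (ip_cat x 0%R) !add0r h.
have e : ksource (a ** x (oarr 0 p)) = ksource (x (oarr 0 p)).
  by rewrite ksource_comp// ip_r.
rewrite kcompA ?ip_r//; last exact: ip_st0.
move/kcompI; apply; last by rewrite e; exact: ip_st0.
rewrite -h; exact: ip_st0.
Qed.

Lemma prefix_ex a x : ksource a = ip_start x -> exists y, is_prefixed a x y.
Proof.
move=> ax.
have axn n : ksource a = krange (x (oarr 0 n)) by rewrite ip_r.
have [f fP] : {f : 'N^k -> L & forall n, kdeg (f n) = n /\
    exists2 b, ksource (f n) = krange b & a ** x (oarr 0 n) = f n ** b}.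
  apply: (@choice _ _ (fun n c => kdeg c = n /\
    exists2 b, ksource c = krange b & a ** x (oarr 0 n) = c ** b)) => n.
  have := kdeg_comp (axn n); rewrite ip_d addrC => /kfact[c [b [e cn _ cb]]].
  by exists c; split=> //; exists b.
have fI n c : kdeg c = n -> (exists m, exists2 b, ksource c = krange b &
    a ** x (oarr 0 (n + m)%R) = c ** b) -> f n = c.
  move=> cn [m [b cb e]]; have [fn [b' fb' e']] := fP n.
  move: e; rewrite ip_cat kcompA//; last exact: ip_st.
  have st : ksource (f n ** b') = krange (x (oarr (0 + n)%R m)).
    by rewrite -e' ksource_comp//; exact: ip_st.
  rewrite ksource_comp// in st.
  rewrite e' -kcompA// => /kfact_inj[]//; first by rewrite krange_comp.
  by rewrite fn.
have [y yP] : exists y, forall n, y (oarr 0 n) = f n.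
  apply: ip_build => [n|n m]; first by have [] := fP n.
  have [fn [b fb e]] := fP n.
  have eb : kdeg b = kdeg a.
    apply: (@addkI _ n); rewrite /= -[X in (X + kdeg b)%R]fn -kdeg_comp// -e.
    by rewrite kdeg_comp// ip_d addrC.
  have st : ksource b = krange (x (oarr n m)).
    by rewrite -(ksource_comp fb) -e ksource_comp//; exact: ip_st0.
  have := kdeg_comp st; rewrite eb ip_d addrC => /kfact[c [d [cdE cm _ cd]]].
  have fc : ksource (f n) = krange c.
    by rewrite fb -(krange_comp st) cdE krange_comp.
  exists c => //; apply: fI; first by rewrite kdeg_comp// fn cm.
  exists 0%R; exists d; first by rewrite ksource_comp.
  rewrite addr0 ip_cat kcompA//; last exact: ip_st.
  by rewrite e add0r -!kcompA// cdE.
exists y; apply/(is_prefixedP _ ax) => n; rewrite yP.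
apply: fI; first by rewrite kdeg_comp// ip_d.
exists 0%R; rewrite addr0 addrC ip_cat.
exists (x (oarr (0 + n)%R (kdeg a))); first by rewrite ksource_comp//; exact: ip_st.
by rewrite kcompA//; exact: ip_st.
Qed.

Lemma pcompP a x : ksource a = ip_start x -> is_prefixed a x (pcomp a x).
Proof. by move=> /prefix_ex; exact: xgetPex. Qed.

Lemma pcompE a x n : ksource a = ip_start x ->
  pcomp a x (oarr 0 (kdeg a + n)%R) = a ** x (oarr 0 n).
Proof. by move=> ax; have /(is_prefixedP _ ax) := pcompP ax. Qed.

Lemma is_prefixed_inj a x y : ksource a = ip_start x -> is_prefixed a x y ->
  y = pcomp a x.
Proof.
move=> ax /(is_prefixedP _ ax) h; apply: (@ip_eq0 _ _ (kdeg a)) => n.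
by rewrite h pcompE.
Qed.

Lemma pcomp0 a x : ksource a = ip_start x -> pcomp a x (oarr 0 (kdeg a)) = a.
Proof. by move=> /pcompP[]. Qed.

Lemma pcomp_start a x : ksource a = ip_start x ->
  ip_start (pcomp a x) = krange a.
Proof. by move=> ax; rewrite -(ip_r _ (kdeg a)) pcomp0. Qed.

Lemma pcompA a b x : ksource a = krange b -> ksource b = ip_start x ->
  pcomp (a ** b) x = pcomp a (pcomp b x).
Proof.
move=> ab bx; have abx : ksource (a ** b) = ip_start x by rewrite ksource_comp.
have abx' : ksource a = ip_start (pcomp b x) by rewrite pcomp_start.
apply: (@ip_eq0 _ _ (kdeg (a ** b))) => n.
by rewrite pcompE// kdeg_comp// -addrA pcompE// pcompE// kcompA// ip_r.
Qed.

Lemma pcomp_id x : pcomp (ip_start x) x = x.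
Proof.
have v0 : kdeg (ip_start x) = 0%R by exact: ip_d.
have [_ vs] := vertex_eq v0.
apply: (@ip_eq0 _ _ 0%R) => n.
have := @pcompE (ip_start x) x n vs; rewrite v0 => ->.
by rewrite add0r -(ip_r x n) krange_id.
Qed.

Lemma ip_shift x n : exists z,
  ksource (x (oarr 0 n)) = ip_start z /\ pcomp (x (oarr 0 n)) z = x.
Proof.
pose sh (a : Omega k) : Omega k := oarr (n + (val a).1)%R (odeg a).
have shr (a : Omega k) : sh (krange a) = krange (sh a).
  by apply: oeqP => /=; rewrite /odeg /= ?subkk ?addr0.
have shs (a : Omega k) : sh (ksource a) = ksource (sh a).
  apply: oeqP => /=; rewrite /odeg /=; first by rewrite -addrA subkK//; exact: (valP a).
  by rewrite subkk addr0 -addrA subkK//; exact: (valP a).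
have she (a : Omega k) : val (sh a) = (n + (val a).1, n + (val a).2)%R.
  by rewrite /= /odeg -addrA subkK//; exact: (valP a).
have shc (a b : Omega k) : ksource a = krange b -> sh (a ** b) = sh a ** sh b.
  move=> ab; have ab' : ksource (sh a) = krange (sh b) by rewrite -shs ab shr.
  by apply: val_inj; rewrite ocompE// !she ocompE.
have shd (a : Omega k) : kdeg (sh a) = kdeg a by rewrite oarr_deg.
have [z zE] : exists z : infpath L, forall a : Omega k, z a = x (sh a).
  unshelve eexists; first (unshelve eapply (@InfPath _ _ (fun a : Omega k => x (sh a)))).
  - by move=> a; rewrite shr ip_range.
  - by move=> a; rewrite shs ip_source.
  - by move=> a b ab; rewrite shc// ip_comp// -shs ab shr.
  - by move=> a; rewrite ip_deg shd.
  by [].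
have zE' p m : z (oarr p m) = x (oarr (n + p)%R m).
  by rewrite zE; congr (x (oarr _ _)); exact: oarr_deg.
have st : ksource (x (oarr 0 n)) = ip_start z.
  by rewrite /ip_start zE' addr0 -ip_source oarr_src add0r.
exists z; split=> //; apply/esym/is_prefixed_inj => //.
by split; rewrite ip_d// => p m; rewrite zE'.
Qed.

Lemma pcomp_inj a b x y : ksource a = ip_start x -> ksource b = ip_start y ->
  kdeg a = kdeg b -> pcomp a x = pcomp b y -> a = b /\ x = y.
Proof.
move=> ax bY dab e.
have ab : a = b by rewrite -(pcomp0 ax) e dab pcomp0.
split=> //; subst b; apply: (@ip_eq0 _ _ 0%R) => n; rewrite add0r.
have := pcompE n ax; rewrite e pcompE// => /esym/kcompI; apply; by rewrite ip_r.
Qed.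

(* two prefixes of the same infinite path have a common extension *)
Lemma common_ext a b x y : ksource a = ip_start x -> ksource b = ip_start y ->
  pcomp a x = pcomp b y ->
  exists c d z, [/\ ksource a = krange c /\ ksource b = krange d,
    ksource c = ip_start z /\ ksource d = ip_start z,
    a ** c = b ** d, x = pcomp c z & y = pcomp d z].
Proof.
move=> ax bY e; pose m := maxk (kdeg a) (kdeg b).
have [z [sz zE]] := ip_shift x (subk m (kdeg a)).
have [w [sw wE]] := ip_shift y (subk m (kdeg b)).
set c := x _ in sz zE; set d := y _ in sw wE.
have ac : ksource a = krange c by rewrite ip_r.
have bd : ksource b = krange d by rewrite ip_r.
have : pcomp (a ** c) z = pcomp (b ** d) w by rewrite !pcompA// zE wE.
move=> /pcomp_inj[]; rewrite ?ksource_comp//.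
  by rewrite !kdeg_comp// !ip_d !subkK// ?lek_maxl ?lek_maxr.
move=> abE zw; rewrite -zw in sw wE.
by exists c, d, z.
Qed.

Definition path_equiv a b : Prop :=
  ksource a = ksource b /\ forall x, ip_from (ksource a) x -> pcomp a x = pcomp b x.

End InfPath.

(* (x, n, y) belongs to the groupoid of L *)
Definition gpd_mem k (L : kgraph k) (x : infpath L) (n : 'Z^k)
    (y : infpath L) : Prop :=
  exists a b z, [/\ ksource a = ksource b, ip_from (ksource a) z,
    x = pcomp a z, n = zdiff (kdeg a) (kdeg b) & y = pcomp b z].

Record gpd (k : nat) (L : kgraph k) := Gpd {
  grange : infpath L;
  gdeg : 'Z^k;
  gsource : infpath L;
  gpdP : gpd_mem grange gdeg gsource
}.

HB.instance Definition _ k (L : kgraph k) := gen_eqMixin (gpd L).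
HB.instance Definition _ k (L : kgraph k) := gen_choiceMixin (gpd L).

Section Groupoid.
Variables (k : nat) (L : kgraph k).
Implicit Types (a b c d : L) (x y z : infpath L) (g h : gpd L).
Implicit Types (U V W : set (gpd L)).

Lemma gpd_eq g h : grange g = grange h -> gdeg g = gdeg h ->
  gsource g = gsource h -> g = h.
Proof.
case: g h => [x n y p] [x' n' y' p'] /= e1 e2 e3.
by subst; congr Gpd; exact: Prop_irrelevance.
Qed.

Lemma gpd_mem1 x : gpd_mem x 0%R x.
Proof.
have [_ vs] := vertex_eq (ip_d x 0%R 0%R).
exists (ip_start x), (ip_start x), x; split=> //; rewrite ?pcomp_id ?zdiffkk//.
Qed.

Lemma gpd_memV x n y : gpd_mem x n y -> gpd_mem y (- n)%R x.
Proof.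
move=> [a [b [z [ab az xE nE yE]]]]; exists b, a, z; split=> //.
  by rewrite -ab.
by rewrite nE zdiffN.
Qed.

Lemma gpd_memM x n y m z :
  gpd_mem x n y -> gpd_mem y m z -> gpd_mem x (n + m)%R z.
Proof.
move=> [a [b [u [ab au -> -> ->]]]] [c [d [w [cd cw e -> ->]]]].
have bu : ksource b = ip_start u by rewrite -ab au.
have [s [t [v [[bs ct] [sv tv] e' uE wE]]]] := common_ext bu (esym cw) e.
have asE : ksource a = krange s by rewrite ab.
have dt : ksource d = krange t by rewrite -cd.
exists (a ** s), (d ** t), v; split.
- by rewrite !ksource_comp// sv tv.
- by rewrite ksource_comp.
- by rewrite uE pcompA.
- rewrite !kdeg_comp//.
  rewrite -(zdiffD (kdeg a) (kdeg b) (kdeg s)) -(zdiffD (kdeg c) (kdeg d) (kdeg t)).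
  by rewrite -(kdeg_comp bs) e' -(kdeg_comp ct) zdiff_add.
- by rewrite wE pcompA.
Qed.

Definition gunit x : gpd L := Gpd (gpd_mem1 x).
Definition ginv g : gpd L := Gpd (gpd_memV (gpdP g)).

Lemma gmul_subproof g h : gsource g = grange h ->
  gpd_mem (grange g) (gdeg g + gdeg h)%R (gsource h).
Proof.
by move=> gh; apply: gpd_memM (gpdP g) _; rewrite gh; exact: gpdP.
Qed.

Definition gmul g h (gh : gsource g = grange h) : gpd L :=
  Gpd (gmul_subproof gh).

(* Z(a, b); used only when ksource a = ksource b *)
Definition gcyl a b : set (gpd L) := [set g | exists2 z, ip_from (ksource a) z &
  [/\ grange g = pcomp a z, gdeg g = zdiff (kdeg a) (kdeg b) &
      gsource g = pcomp b z]].

Definition gbase : set (set (gpd L)) :=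
  [set W | exists a b, ksource a = ksource b /\ W = gcyl a b].

Lemma gcyl_ex g : exists a b, ksource a = ksource b /\ gcyl a b g.
Proof.
by have [a [b [z [ab az xE nE yE]]]] := gpdP g; exists a, b; split=> //; exists z.
Qed.

Lemma gcyl_sub a b c : ksource a = ksource b -> ksource a = krange c ->
  gcyl (a ** c) (b ** c) `<=` gcyl a b.
Proof.
move=> ab ac g [z cz [gr gd gs]]; have bc : ksource b = krange c by rewrite -ab.
rewrite /ip_from /= ksource_comp// in cz.
exists (pcomp c z); first by rewrite /ip_from /= pcomp_start.
by split; rewrite ?gr ?gs ?pcompA// gd !kdeg_comp// zdiffD.
Qed.

Lemma gcyl_refine a b c d g : ksource a = ksource b -> ksource c = ksource d ->
  gcyl a b g -> gcyl c d g -> exists2 e, ksource a = krange e &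
    gcyl (a ** e) (b ** e) g /\ gcyl (a ** e) (b ** e) `<=` gcyl c d.
Proof.
move=> ab cd [z az [r1 d1 s1]] [w cw [r2 d2 s2]].
rewrite /ip_from /= in az cw.
have e : pcomp a z = pcomp c w by rewrite -r1 -r2.
have [s [t [v [[as_ ct] [sv tv] e' zE wE]]]] := common_ext (esym az) (esym cw) e.
have bs : ksource b = krange s by rewrite -ab.
have dt : ksource d = krange t by rewrite -cd.
exists s => //.
have bd : b ** s = d ** t.
  have : pcomp (b ** s) v = pcomp (d ** t) v.
    by rewrite !pcompA// -zE -wE -s1 -s2.
  move=> /pcomp_inj[]; rewrite ?ksource_comp// !kdeg_comp//.
  apply: (@zdiffDI _ (kdeg a) _ (kdeg c)); first by rewrite -d1 -d2.
  by rewrite -!kdeg_comp// e'.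
split; last by rewrite e' bd; exact: gcyl_sub.
exists v; first by rewrite /ip_from /= ksource_comp.
split; rewrite ?pcompA ?kdeg_comp// -?zE ?r1 ?s1//.
by rewrite zdiffD.
Qed.

Lemma gbase_cover : \bigcup_(W in gbase) W = [set: gpd L].
Proof.
rewrite -subTset => g _; have [a [b [ab gab]]] := gcyl_ex g.
by exists (gcyl a b) => //; exists a, b.
Qed.

Lemma gbase_join (V W : set (gpd L)) g : gbase V -> gbase W -> V g -> W g ->
  exists T, [/\ gbase T, T g & T `<=` V `&` W].
Proof.
move=> [a [b [ab ->]]] [c [d [cd ->]]] gab gcd.
have [e ae [ge sub]] := gcyl_refine ab cd gab gcd.
exists (gcyl (a ** e) (b ** e)); split=> //.
  exists (a ** e), (b ** e); split=> //.
  by rewrite !ksource_comp// -ab.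
by move=> h he; split; [exact: (gcyl_sub ab ae)|exact: sub].
Qed.

End Groupoid.

HB.instance Definition _ k (L : kgraph k) :=
  @isBaseTopological.Build (gpd L) (set (gpd L)) (@gbase k L) id
    (@gbase_cover k L) (@gbase_join k L).

Section Bisections.
Variables (k : nat) (L : kgraph k).
Implicit Types (a b c d : L) (x y z : infpath L) (g h : gpd L).
Implicit Types (U V W : set (gpd L)).

Definition bisection U := set_inj U (@grange k L) /\ set_inj U (@gsource k L).
Definition full U :=
  @gsource k L @` U = [set: infpath L] /\ @grange k L @` U = [set: infpath L].

Definition bimul U V : set (gpd L) := [set t | exists g h
  (gh : gsource g = grange h), [/\ U g, V h & t = gmul gh]].
Definition biinv U : set (gpd L) := @ginv k L @` U.
Definition biunit : set (gpd L) := range (@gunit k L).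

(* pi_U = r o (s|_U)^-1; the default value [gunit] of the partial inverse is
   never reached when U is full *)
Definition bimap U : infpath L -> infpath L :=
  @grange k L \o 'pinv_(@gunit k L) U (@gsource k L).

Lemma gopenP U : open U <-> forall g, U g -> exists a b,
  [/\ ksource a = ksource b, gcyl a b g & gcyl a b `<=` U].
Proof.
split=> [[D sD <-] g [W DW Wg]|h].
  have [a [b [ab WE]]] := sD _ DW; exists a, b; split=> //; first by rewrite -WE.
  by rewrite -WE => t Wt; exists W.
exists [set W | gbase W /\ W `<=` U]; first by move=> W [].
rewrite eqEsubset; split=> [g [W [_ WU]] /WU//|g /h[a [b [ab gab sub]]]].
by exists (gcyl a b) => //; split=> //; exists a, b.
Qed.

Lemma gcyl_open a b : ksource a = ksource b -> open (gcyl a b).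
Proof. by move=> ab; apply/gopenP => g gab; exists a, b; split. Qed.

Lemma gnbhsP g U : nbhs g U <-> exists a b,
  [/\ ksource a = ksource b, gcyl a b g & gcyl a b `<=` U].
Proof.
rewrite nbhsE; split=> [[W [/gopenP oW Wg] sub]|[a [b [ab gab sub]]]].
  have [a [b [ab gab sW]]] := oW _ Wg; exists a, b; split=> //.
  exact: subset_trans sub.
by exists (gcyl a b) => //; split=> //; exact: gcyl_open.
Qed.

Lemma ginvK : involutive (@ginv k L).
Proof. by move=> g; apply: gpd_eq => //=; rewrite opprK. Qed.

Lemma gcyl_inv a b g : ksource a = ksource b -> gcyl a b g -> gcyl b a (ginv g).
Proof.
move=> ab [z az [gr gd gs]]; exists z; first by rewrite -ab.
by split=> //=; rewrite gd zdiffN.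
Qed.

Lemma biinvE U : biinv U = @ginv k L @^-1` U.
Proof.
rewrite eqEsubset; split=> [_ [g Ug <-]|g Ug]; first by rewrite /= ginvK.
by exists (ginv g) => //; rewrite ginvK.
Qed.

Lemma ginv_continuous : continuous (@ginv k L).
Proof.
move=> g W /gnbhsP[a [b [ab gab sub]]]; apply/gnbhsP.
exists b, a; split=> //; first by rewrite -[g]ginvK; exact: gcyl_inv.
by move=> h hba; apply: sub; exact: gcyl_inv.
Qed.

Lemma biinv_open U : open U -> open (biinv U).
Proof. rewrite biinvE; apply: open_comp => g _; exact: ginv_continuous. Qed.

Lemma biinv_compact U : compact U -> compact (biinv U).
Proof.
apply: continuous_compact; apply: continuous_subspaceT.
exact: ginv_continuous.
Qed.

Lemma biinv_bisection U : bisection U -> bisection (biinv U).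
Proof.
move=> [ir is_]; split=> _ _ /set_mem[g Ug <-] /set_mem[h Uh <-] /= e; congr ginv.
  by apply: is_ => //; exact/mem_set.
by apply: ir => //; exact/mem_set.
Qed.

Lemma biinv_full U : full U -> full (biinv U).
Proof.
move=> [fs fr]; split; rewrite -subTset => x _.
  have : [set: infpath L] x by []. rewrite -fr => -[g Ug <-].
  by exists (ginv g) => //; exists g.
have : [set: infpath L] x by []. rewrite -fs => -[g Ug <-].
by exists (ginv g) => //; exists g.
Qed.

Lemma gcyl_mul a b d g h (gh : gsource g = grange h) :
  ksource a = ksource b -> ksource b = ksource d ->
  gcyl a b g -> gcyl b d h -> gcyl a d (gmul gh).
Proof.
move=> ab bd [z az [r1 d1 s1]] [w bw [r2 d2 s2]].
rewrite /ip_from /= in az bw.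
have [_ zw] : b = b /\ z = w.
  by apply: pcomp_inj; rewrite -?s1 -?r2 ?az ?bw.
exists z => //; split=> //=; first by rewrite d1 d2 zdiff_add.
by rewrite zw.
Qed.

(* locally at a composable pair the product looks like Z(a, b) Z(b, d) *)
Lemma gmul_local g h (gh : gsource g = grange h) U V W :
  nbhs g U -> nbhs h V -> nbhs (gmul gh) W -> exists a b d,
  [/\ ksource a = ksource b, ksource b = ksource d,
      gcyl a b g /\ gcyl b d h &
      [/\ gcyl a b `<=` U, gcyl b d `<=` V & gcyl a d `<=` W]].
Proof.
move=> /gnbhsP[a [b [ab gab sU]]] /gnbhsP[c [d [cd hcd sV]]].
move=> /gnbhsP[m [n [mn gmn sW]]].
case: (gab) (hcd) => z az [r1 d1 s1] [w cw [r2 d2 s2]].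
rewrite /ip_from /= in az cw.
have bz : ksource b = ip_start z by rewrite -ab az.
have e : pcomp b z = pcomp c w by rewrite -s1 -r2.
have [s [t [v [[bs ct] [sv tv] e' zE wE]]]] := common_ext bz (esym cw) e.
have as_ : ksource a = krange s by rewrite ab.
have dt : ksource d = krange t by rewrite -cd.
have gs : gcyl (a ** s) (b ** s) g.
  exists v; first by rewrite /ip_from /= ksource_comp.
  by rewrite !pcompA// -zE !kdeg_comp// zdiffD.
have ht : gcyl (b ** s) (d ** t) h.
  exists v; first by rewrite /ip_from /= ksource_comp.
  by rewrite e' !pcompA// -wE !kdeg_comp// zdiffD.
have abs : ksource (a ** s) = ksource (b ** s) by rewrite !ksource_comp.
have bds : ksource (b ** s) = ksource (d ** t) by rewrite !ksource_comp// sv.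
have ads : ksource (a ** s) = ksource (d ** t) by rewrite abs.
have gm : gcyl (a ** s) (d ** t) (gmul gh) by exact: gcyl_mul gs ht.
have [f asf [gf sf]] := gcyl_refine ads mn gm gmn.
have bsf : ksource (b ** s) = krange f by rewrite -abs.
have dtf : ksource (d ** t) = krange f by rewrite -ads.
have [u fu [r3 d3 s3]] := gf.
rewrite /ip_from /= ksource_comp// in fu.
rewrite /= in r3 s3.
have vu : v = pcomp f u.
  have h1 : grange g = pcomp (a ** s) v by rewrite r1 zE pcompA.
  have := r3; rewrite h1 (pcompA asf (esym fu)) => /pcomp_inj[]//.
    by rewrite ksource_comp.
  by rewrite (pcomp_start (esym fu)).
have fu' := esym fu.
exists (a ** s ** f), (b ** s ** f), (d ** t ** f); split.
- by rewrite (ksource_comp asf) (ksource_comp bsf).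
- by rewrite (ksource_comp bsf) (ksource_comp dtf).
- split; exists u; rewrite /ip_from /= ?(ksource_comp asf) ?(ksource_comp bsf)//.
  all: split.
  + exact: r3.
  + by rewrite !(kdeg_comp asf, kdeg_comp bsf) zdiffD !kdeg_comp// zdiffD.
  + by rewrite pcompA// -vu s1 zE pcompA.
  + by rewrite pcompA// -vu e' r2 wE pcompA.
  + by rewrite !(kdeg_comp bsf, kdeg_comp dtf) zdiffD e' !kdeg_comp// zdiffD.
  + exact: s3.
  + by apply: subset_trans sU; apply: subset_trans (gcyl_sub ab as_); exact: gcyl_sub.
  + apply: subset_trans sV; apply: subset_trans (gcyl_sub cd ct); rewrite -e'.
    exact: gcyl_sub.
  + exact: subset_trans sW.
Qed.

Lemma bimul_open U V : open U -> open V -> open (bimul U V).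
Proof.
move=> oU oV; apply/gopenP => _ [g [h [gh [Ug Vh ->]]]].
have [a [b [d [ab bd [gab hbd] [sU sV _]]]]] := gmul_local
  (open_nbhs_nbhs (conj oU Ug)) (open_nbhs_nbhs (conj oV Vh))
  (@filterT _ (nbhs (gmul gh)) _).
have ad : ksource a = ksource d by rewrite ab.
exists a, d; split=> //; first exact: gcyl_mul gab hbd.
move=> t [z az [r1 d1 s1]]; rewrite /ip_from /= in az.
have m1 : gpd_mem (pcomp a z) (zdiff (kdeg a) (kdeg b)) (pcomp b z).
  by exists a, b, z.
have m2 : gpd_mem (pcomp b z) (zdiff (kdeg b) (kdeg d)) (pcomp d z).
  by exists b, d, z; split=> //; rewrite /ip_from /= -ab.
exists (Gpd m1), (Gpd m2), erefl; split.
- by apply: sU; exists z.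
- by apply: sV; exists z => //; rewrite /ip_from /= -ab.
- by apply: gpd_eq => //=; rewrite d1 zdiff_add.
Qed.

Lemma bimul_compact U V : compact U -> open U -> open V ->
  set_inj V (@grange k L) -> @grange k L @` V = [set: infpath L] ->
  compact (bimul U V).
Proof.
move=> cU oU oV iV fV.
pose M g := [set t | exists h (gh : gsource g = grange h), V h /\ t = gmul gh].
have Mex g : M g !=set0.
  have : [set: infpath L] (gsource g) by [].
  by rewrite -fV => -[h Vh /esym gh]; exists (gmul gh), h, gh.
have Mu g : is_subset1 (M g).
  move=> _ _ [h [gh [Vh ->]]] [h' [gh' [Vh' ->]]].
  have e : h = h' by apply: iV; rewrite ?mem_set// -gh -gh'.
  by subst h'; congr gmul; exact: Prop_irrelevance.
pose phi g := xget g (M g).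
have phiE g h (gh : gsource g = grange h) : V h -> phi g = gmul gh.
  by move=> Vh; apply: xget_subset1 (Mu g); exists h, gh.
have -> : bimul U V = phi @` U.
  rewrite eqEsubset; split=> [_ [g [h [gh [Ug Vh ->]]]]|_ [g Ug <-]].
    by exists g => //; exact: phiE.
  have [_ [h [gh [Vh _]]]] := Mex g.
  by rewrite (phiE _ _ gh)//; exists g, h, gh.
apply: continuous_compact => //; rewrite continuous_open_subspace//.
move=> g /set_mem Ug W.
have [_ [h [gh [Vh _]]]] := Mex g.
rewrite (phiE _ _ gh)// => nW; have [a [b [d [ab bd [gab hbd] [sU sV sW]]]]] :=
  gmul_local (open_nbhs_nbhs (conj oU Ug)) (open_nbhs_nbhs (conj oV Vh)) nW.
apply/gnbhsP; exists a, b; split=> // g' g'ab /=.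
apply: sW; have [z az [r1 d1 s1]] := g'ab; rewrite /ip_from /= in az.
have m2 : gpd_mem (pcomp b z) (zdiff (kdeg b) (kdeg d)) (pcomp d z).
  by exists b, d, z; split=> //; rewrite /ip_from /= -ab.
have h2 : gcyl b d (Gpd m2) by exists z => //; rewrite /ip_from /= -ab.
by rewrite (phiE _ (Gpd m2) s1); [exact: gcyl_mul g'ab h2|exact: sV].
Qed.

Lemma bimul_bisection U V : bisection U -> bisection V -> bisection (bimul U V).
Proof.
move=> [rU sU] [rV sV]; split=> t t' /set_mem[g [h [gh [Ug Vh ->]]]]
  /set_mem[g' [h' [gh' [Ug' Vh' ->]]]] /= e; apply: gpd_eq => //=.
- have {}e : g = g' by apply: rU => //; exact/mem_set.
  by subst g'; have -> : h = h' by apply: rV; rewrite ?mem_set// -gh -gh'.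
- have {}e : g = g' by apply: rU => //; exact/mem_set.
  by subst g'; have -> : h = h' by apply: rV; rewrite ?mem_set// -gh -gh'.
- have {}e : h = h' by apply: sV => //; exact/mem_set.
  by subst h'; have -> : g = g' by apply: sU; rewrite ?mem_set// gh gh'.
- have {}e : h = h' by apply: sV => //; exact/mem_set.
  by subst h'; have -> : g = g' by apply: sU; rewrite ?mem_set// gh gh'.
Qed.

Lemma full_source U y : full U -> exists2 g, U g & gsource g = y.
Proof. by move=> [fs _]; have : [set: infpath L] y by []; rewrite -fs. Qed.

Lemma full_range U y : full U -> exists2 g, U g & grange g = y.
Proof. by move=> [_ fr]; have : [set: infpath L] y by []; rewrite -fr. Qed.

Lemma bimul_full U V : full U -> full V -> full (bimul U V).
Proof.
move=> fU fV; split; rewrite -subTset => x _.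
  have [h Vh <-] := full_source x fV.
  have [g Ug gh] := full_source (grange h) fU.
  by exists (gmul gh) => //; exists g, h, gh.
have [g Ug <-] := full_range x fU.
have [h Vh /esym gh] := full_range (gsource g) fV.
by exists (gmul gh) => //; exists g, h, gh.
Qed.

Lemma biunit_open : open biunit.
Proof.
apply/gopenP => _ [x _ <-].
have [_ vs] := vertex_eq (ip_d x 0%R 0%R); rewrite -/(ip_start x) in vs.
exists (ip_start x), (ip_start x); split=> //.
  by exists x => //; rewrite ?pcomp_id ?zdiffkk.
move=> g [z _ [r1 d1 s1]]; exists (grange g) => //.
by apply: gpd_eq => //=; rewrite ?d1 ?zdiffkk// r1 s1.
Qed.

Lemma biunit_bisection : bisection biunit.
Proof.
by split=> _ _ /set_mem[x _ <-] /set_mem[y _ <-] /= ->.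
Qed.

Lemma biunit_full : full biunit.
Proof.
by split; rewrite -subTset => x _; exists (gunit x) => //; exists x.
Qed.

Lemma gcyl_unit a x : gcyl a a (gunit x) -> a = x (oarr 0 (kdeg a)).
Proof. by move=> [z az [/= -> _ _]]; rewrite pcomp0. Qed.

Lemma klevel_finite n : row_finite L -> finitely_many_vertices L ->
  finite_set (@klevel k L n).
Proof.
move=> rf fv.
have : finite_set (\bigcup_(v in @klevel k L 0%R) kfrom v n).
  by apply: bigcup_finite => // v v0; exact: rf.
apply: sub_finite_set => a an; exists (krange a) => //.
exact: kdeg_range.
Qed.

Lemma ultra_cover (T I : Type) (F : set_system T) (D : set I) (f : I -> set T) :
  UltraFilter F -> finite_set D -> F (\bigcup_(i in D) f i) ->
  exists2 i, D i & F (f i).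
Proof.
move=> FU; elim/Pchoice: I => I in D f *.
move=> /finite_setP[n]; elim: n D => [|n IH] D.
  by rewrite II0 card_eq0 => /eqP ->; rewrite bigcup_set0 => /filter_not_empty.
move=> /eq_cardSP[i Di /IH{}IH] FD.
have [?|Fi] := in_ultra_setVsetC (f i) FU; first by exists i.
have [|j [Dj _] Fj] := IH; last by exists j.
apply: filterS (filterI FD Fi) => t [[j Dj fj] nfi].
by exists j => //; split=> // ji; apply: nfi; rewrite -ji.
Qed.

Lemma biunit_compact : row_finite L -> finitely_many_vertices L ->
  compact biunit.
Proof.
move=> rf fv; rewrite compact_ultra => F FU FE.
have cyl n : exists a, kdeg a = n /\ F (gcyl a a).
  have [||a an Fa] := @ultra_cover _ _ F (@klevel k L n) (fun a => gcyl a a) FU.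
  - exact: klevel_finite.
  - apply: filterS FE => _ [x _ <-].
    have [z [st zE]] := ip_shift x n.
    exists (x (oarr 0 n)); first exact: ip_d.
    by exists z => //=; rewrite zE zdiffkk.
  by exists a.
have [f fP] := choice cyl.
have fd n : kdeg (f n) = n by have [] := fP n.
have fF n : F (gcyl (f n) (f n)) by have [] := fP n.
have fh n m : exists2 b, ksource (f n) = krange b & f (n + m)%R = f n ** b.
  have : F (biunit `&` (gcyl (f n) (f n) `&` gcyl (f (n + m)%R) (f (n + m)%R))).
    by apply: filterI => //; exact: filterI.
  move=> /filter_ex[_ [[x _ <-] [/gcyl_unit e1 /gcyl_unit e2]]].
  rewrite !fd in e1 e2; exists (x (oarr n m)).
    by rewrite e1; exact: ip_st0.
  by rewrite e1 e2 ip_cat add0r.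
have [y yE] := ip_build fd fh.
exists (gunit y); split; first by exists y.
move=> W /gnbhsP[a [b [ab [z az [/= e1 e2 e3]] sW]]].
have dab : kdeg a = kdeg b.
  apply/ffunP => i; move/ffunP/(_ i): e2; rewrite !ffunE => /esym/eqP.
  by rewrite subr_eq0 eqz_nat => /eqP.
rewrite /ip_from /= in az.
have [ba _] : a = b /\ z = z.
  by apply: pcomp_inj; rewrite -?e1 -?e3 -?ab ?az.
subst b; apply: filterS sW _; have -> : a = f (kdeg a); last exact: fF.
by rewrite -yE e1 pcomp0.
Qed.

Lemma bimapE U g : bisection U -> U g -> bimap U (gsource g) = grange g.
Proof.
move=> [_ iU] Ug; rewrite /bimap /= pinvKV//; exact/mem_set.
Qed.

Lemma bimap_mul U V : bisection U -> full U -> bisection V -> full V ->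
  bimap (bimul U V) = bimap U \o bimap V.
Proof.
move=> bU fU bV fV; apply/funext => y /=.
have [h Vh <-] := full_source y fV; rewrite (bimapE bV Vh).
have [g Ug gh] := full_source (grange h) fU; rewrite -gh (bimapE bU Ug).
rewrite -[gsource h]/(gsource (gmul gh)) bimapE//; last by exists g, h, gh.
exact: bimul_bisection.
Qed.

Lemma bimap_unit : bimap biunit = id.
Proof.
apply/funext => y; rewrite -[y in LHS]/(gsource (gunit y)) bimapE//.
  exact: biunit_bisection.
by exists y.
Qed.

Lemma bimulA U V W : bimul U (bimul V W) = bimul (bimul U V) W.
Proof.
rewrite eqEsubset; split=> t.
  move=> [g [u [e1 [Ug [h [w [e2 [Vh Ww uE]]]] ->]]]].
  have gh : gsource g = grange h by rewrite e1 uE.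
  exists (gmul gh), w, e2; split=> //; first by exists g, h, gh.
  by apply: gpd_eq; rewrite //= uE //= addrA.
move=> [u [w [e1 [[g [h [e2 [Ug Vh uE]]]] Ww ->]]]].
have hw : gsource h = grange w by rewrite -e1 uE.
exists g, (gmul hw), e2; split=> //; first by exists h, w, hw.
by apply: gpd_eq; rewrite //= uE //= addrA.
Qed.

Lemma bimul1 U : bimul biunit U = U.
Proof.
rewrite eqEsubset; split=> [t [u [h [e [[x _ xu] Uh ->]]]]|g Ug].
  subst u; by have -> : gmul e = h by apply: gpd_eq => //=; rewrite add0r.
exists (gunit (grange g)), g, erefl; split=> //; first by exists (grange g).
by apply: gpd_eq => //=; rewrite add0r.
Qed.

Lemma bimulr1 U : bimul U biunit = U.
Proof.
rewrite eqEsubset; split=> [t [g [u [e [Ug [x _ xu] ->]]]]|g Ug].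
  subst u; by have -> : gmul e = g by apply: gpd_eq => //=; rewrite addr0.
exists g, (gunit (gsource g)), erefl; split=> //; first by exists (gsource g).
by apply: gpd_eq => //=; rewrite addr0.
Qed.

Lemma bimulV U : bisection U -> full U -> bimul U (biinv U) = biunit.
Proof.
move=> [_ iU] fU; rewrite eqEsubset; split=> [t [g [u [e [Ug [h Uh hu] ->]]]]|_ [x _ <-]].
  subst u.
  have gh : g = h by apply: iU; rewrite ?mem_set.
  subst h; exists (grange g) => //; by apply: gpd_eq => //=; rewrite subrr.
have [g Ug <-] := full_range x fU.
exists g, (ginv g), erefl; split=> //; first by exists g.
by apply: gpd_eq => //=; rewrite subrr.
Qed.

Lemma biinvK U : biinv (biinv U) = U.
Proof. by rewrite !biinvE; apply/seteqP; split=> g /=; rewrite ginvK. Qed.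

Lemma bimulVr U : bisection U -> full U -> bimul (biinv U) U = biunit.
Proof.
move=> bU fU; rewrite -[X in bimul _ X]biinvK bimulV//.
  exact: biinv_bisection.
exact: biinv_full.
Qed.

End Bisections.

(* The proofs of row-finiteness and of finiteness of the vertex set are
   parameters because they make the unit space compact, which is what gives the
   group of full compact open bisections its identity. *)
Record full_group (k : nat) (L : kgraph k) (rf : row_finite L)
    (fv : finitely_many_vertices L) := FullGroup {
  fg_set :> set (gpd L);
  fg_compact : compact fg_set;
  fg_open : open fg_set;
  fg_bisection : bisection fg_set;
  fg_full : full fg_set
}.

Record topological_full_group (k : nat) (L : kgraph k) (rf : row_finite L)
    (fv : finitely_many_vertices L) := TopologicalFullGroup {
  tf_fun :> infpath L -> infpath L;
  tfP : exists U : full_group rf fv, tf_fun = bimap U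
}.

Section Groups.
Variables (k : nat) (L : kgraph k).
Variables (rf : row_finite L) (fv : finitely_many_vertices L).
Local Notation F := (full_group rf fv).
Local Notation T := (topological_full_group rf fv).
Implicit Types (U V W : F) (f g h : T).

Lemma fg_eq U V : fg_set U = fg_set V -> U = V.
Proof.
case: U V => [U c o b u] [V c' o' b' u'] /= e.
by subst V; congr FullGroup; exact: Prop_irrelevance.
Qed.

Lemma tf_eq f g : tf_fun f = tf_fun g -> f = g.
Proof.
case: f g => [f p] [g q] /= e.
by subst g; congr TopologicalFullGroup; exact: Prop_irrelevance.
Qed.

Definition fg_one : F := FullGroup rf fv (biunit_compact rf fv)
  (@biunit_open k L) (@biunit_bisection k L) (@biunit_full k L).

Definition fg_inv U : F := FullGroup rf fv (biinv_compact (@fg_compact _ _ _ _ U))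
  (biinv_open (@fg_open _ _ _ _ U)) (biinv_bisection (fg_bisection U))
  (biinv_full (fg_full U)).

Definition fg_mul U V : F := FullGroup rf fv
  (bimul_compact (@fg_compact _ _ _ _ U) (@fg_open _ _ _ _ U)
    (@fg_open _ _ _ _ V) (fg_bisection V).1 (fg_full V).2)
  (bimul_open (@fg_open _ _ _ _ U) (@fg_open _ _ _ _ V))
  (bimul_bisection (fg_bisection U) (fg_bisection V))
  (bimul_full (fg_full U) (fg_full V)).

Lemma fg_mulA : associative fg_mul.
Proof. by move=> U V W; apply: fg_eq; exact: bimulA. Qed.

Lemma fg_mul1 : left_id fg_one fg_mul.
Proof. by move=> U; apply: fg_eq; exact: bimul1. Qed.

Lemma fg_mulr1 : right_id fg_one fg_mul.
Proof. by move=> U; apply: fg_eq; exact: bimulr1. Qed.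

Lemma fg_mulV : left_inverse fg_one fg_inv fg_mul.
Proof.
move=> U; apply: fg_eq; exact: bimulVr (fg_bisection U) (fg_full U).
Qed.

Lemma fg_mulVr : right_inverse fg_one fg_inv fg_mul.
Proof.
move=> U; apply: fg_eq; exact: bimulV (fg_bisection U) (fg_full U).
Qed.

HB.instance Definition _ := gen_eqMixin F.
HB.instance Definition _ := gen_choiceMixin F.
HB.instance Definition _ :=
  isGroup.Build F fg_mulA fg_mul1 fg_mulr1 fg_mulV fg_mulVr.

Definition fg_pi U : T :=
  @TopologicalFullGroup _ _ rf fv (bimap U) (ex_intro _ U erefl).

Lemma fg_pi_surj f : exists U, fg_pi U = f.
Proof. by have [U e] := tfP f; exists U; exact: tf_eq. Qed.

Lemma bimap_fg_mul U V : bimap (fg_mul U V) = bimap U \o bimap V.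
Proof.
exact: bimap_mul (fg_bisection U) (fg_full U) (fg_bisection V) (fg_full V).
Qed.

Lemma tf_mul_subproof f g : exists U : F, f \o g = bimap U.
Proof.
have [U ->] := tfP f; have [V ->] := tfP g.
by exists (fg_mul U V); rewrite bimap_fg_mul.
Qed.

Definition tf_mul f g : T := TopologicalFullGroup (tf_mul_subproof f g).

Lemma tf_one_subproof : exists U : F, id = bimap U.
Proof. by exists fg_one; rewrite bimap_unit. Qed.

Definition tf_one : T := TopologicalFullGroup tf_one_subproof.

Lemma tf_inv_ex f : exists g, tf_mul f g = tf_one /\ tf_mul g f = tf_one.
Proof.
have [U Uf] := tfP f; exists (fg_pi (fg_inv U)).
have hr : bimap U \o bimap (fg_inv U) = id.
  by rewrite -bimap_fg_mul fg_mulVr bimap_unit.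
have hl : bimap (fg_inv U) \o bimap U = id.
  by rewrite -bimap_fg_mul fg_mulV bimap_unit.
split; apply: tf_eq; first by rewrite -[RHS]hr -Uf.
by rewrite -[RHS]hl -Uf.
Qed.

Definition tf_inv f : T := projT1 (cid (tf_inv_ex f)).

Lemma tf_mulA : associative tf_mul.
Proof. by move=> f g h; exact: tf_eq. Qed.

Lemma tf_mul1 : left_id tf_one tf_mul.
Proof. by move=> f; exact: tf_eq. Qed.

Lemma tf_mulr1 : right_id tf_one tf_mul.
Proof. by move=> f; exact: tf_eq. Qed.

Lemma tf_mulV : left_inverse tf_one tf_inv tf_mul.
Proof. by move=> f; rewrite /tf_inv; case: cid => g []. Qed.

Lemma tf_mulVr : right_inverse tf_one tf_inv tf_mul.
Proof. by move=> f; rewrite /tf_inv; case: cid => g []. Qed.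

HB.instance Definition _ := gen_eqMixin T.
HB.instance Definition _ := gen_choiceMixin T.
HB.instance Definition _ :=
  isGroup.Build T tf_mulA tf_mul1 tf_mulr1 tf_mulV tf_mulVr.

Lemma fg_pi_monoid_morphism :
  (fg_pi 1%g = 1%g) * {morph fg_pi : U V / (U * V)%g}.
Proof.
split=> [|U V]; apply: tf_eq; first exact: bimap_unit.
exact: bimap_fg_mul.
Qed.

HB.instance Definition _ :=
  isUMagmaMorphism.Build F T fg_pi fg_pi_monoid_morphism.

End Groups.

Arguments fg_pi {k L} rf fv.

Definition gker (G H : groupType) (f : {multiplicative G -> H}) : set G :=
  [set x | f x = 1%g].

(* Main.v *)
Require Import Defs.
From mathcomp Require Import all_boot.
From mathcomp Require Import boolp classical_sets.
From mathcomp Require Import ssralg functions cardinality filter topology.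
Import Defs.

Set Implicit Arguments.
Unset Strict Implicit.
Unset Printing Implicit Defensive.

Local Open Scope classical_set_scope.

(** An element [U] of the full group acts trivially on infinite paths exactly
    when each of its arrows has equal range and source.  Since the arrows of a
    cylinder [Z(a, b)] are the [(a z, d(a) - d(b), b z)], a cylinder inside [U]
    consists of such arrows if and only if [a] and [b] are equivalent paths.
    Hence any decomposition of [U] into cylinders decides whether [U] lies in
    the kernel, and what remains is that a finite disjoint decomposition exists
    ([compact_open_gcyl_partition]).

    For the latter, cut all cylinders at one common degree [m].  A cylinder
    [Z(a, b)] inside [U] splits into the cylinders [Z(a e, b e)] with
    [d(a e) = m] as soon as [d(a) <= m], so compactness of [U] supplies an [m]
    for which the cylinders [Z(a, b)] inside [U] with [d(a) = m] cover [U].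
    There are finitely many candidates for [a], because the graph is row-finite
    with finitely many vertices; injectivity of the range map on [U] determines
    [b] from [a]; and two such cylinders with distinct [a] are disjoint, because
    [a] is the initial segment of degree [m] of the range of any arrow in
    [Z(a, b)]. *)

Lemma finite_set_enum (T : Type) (D : set T) : finite_set D ->
  exists n (f : 'I_n -> T), injective f /\ D = range f.
Proof.
elim/Pchoice: T D => T D /finite_seqP[s ->].
exists (size (undup s)), (tnth (in_tuple (undup s))); split.
  by apply/tuple_uniqP; exact: undup_uniq.
apply/seteqP; split=> [x /= xs|_ [i _ <-] /=]; last first.
  by rewrite -mem_undup mem_tnth.
have /tnthP[i ->] : x \in in_tuple (undup s) by rewrite mem_undup.
by exists i.
Qed.

Section CylinderPartition.
Variables (k : nat) (L : kgraph k).
Implicit Types (a b c e : L) (z : infpath L) (g : gpd L) (U : set (gpd L)).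

Lemma gcyl_exists a b z : ksource a = ksource b -> ksource a = ip_start z ->
  exists2 g, gcyl a b g & grange g = pcomp a z /\ gsource g = pcomp b z.
Proof.
move=> ab az.
have m : gpd_mem (pcomp a z) (zdiff (kdeg a) (kdeg b)) (pcomp b z).
  by exists a, b, z; split.
by exists (Gpd m) => //; exists z.
Qed.

Lemma gcyl_cut a b g (m : 'N^k) : ksource a = ksource b -> gcyl a b g ->
  lek (kdeg a) m -> exists e, [/\ ksource a = krange e, kdeg (a ** e) = m &
    gcyl (a ** e) (b ** e) g].
Proof.
move=> ab [z az [r1 d1 s1]] am; rewrite /ip_from /= in az.
have [w [sw wE]] := ip_shift z (subk m (kdeg a)).
set e := z _ in sw wE.
have ae : ksource a = krange e by rewrite ip_r.
have be : ksource b = krange e by rewrite -ab.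
exists e; split=> //; first by rewrite kdeg_comp// ip_d subkK.
exists w; first by rewrite /ip_from /= ksource_comp.
by split; rewrite ?pcompA// ?wE// d1 !kdeg_comp// zdiffD.
Qed.

(** The left label of a cylinder is read off from any of its arrows once its
    degree is known, and the right label then follows from the degree and the
    source of the arrow. *)
Lemma gcyl_label_inj a b a' b' g : ksource a = ksource b ->
  ksource a' = ksource b' -> kdeg a = kdeg a' ->
  gcyl a b g -> gcyl a' b' g -> a = a' /\ b = b'.
Proof.
move=> ab ab' dd [z az [r1 d1 s1]] [w aw [r2 d2 s2]].
rewrite /ip_from /= in az aw.
have [aa zw] : a = a' /\ z = w by apply: pcomp_inj; rewrite -?r1 -?r2 ?az ?aw.
subst a' w; split=> //.
have db : kdeg b = kdeg b'.
  rewrite -[LHS]GRing.addr0 -[RHS]GRing.addr0.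
  by apply: (@zdiffDI _ (kdeg a) _ (kdeg a)); rewrite -?d1 -?d2.
have [] // : b = b' /\ z = z.
by apply: pcomp_inj; rewrite -?ab -?ab' -?s1 -?s2 ?az.
Qed.

(** The condition that the cylinder be nonempty makes [b] a function of [a] when
    range is injective on [U]. *)
Definition gcyl_in U (m : 'N^k) a b : Prop :=
  [/\ kdeg a = m, ksource a = ksource b, gcyl a b !=set0 & gcyl a b `<=` U].

Lemma gcyl_in_inj U m a b b' : set_inj U (@grange k L) ->
  gcyl_in U m a b -> gcyl_in U m a b' -> b = b'.
Proof.
move=> iU [_ ab [g gab] sU] [_ ab' _ sU'].
have [z az [r1 d1 s1]] := gab; rewrite /ip_from /= in az.
have [h hab [r2 s2]] := gcyl_exists ab' (esym az).
have gh : g = h.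
  by apply: iU; rewrite ?mem_set//; [exact: sU|exact: sU'|rewrite r1 r2].
by subst h; have [_ ->] := gcyl_label_inj ab ab' erefl gab hab.
Qed.

(** Refining to a larger degree keeps an arrow covered, so the degrees that work
    near a given arrow form a cofinal up-set; compactness makes one degree work
    for the whole of [U]. *)
Lemma compact_gcyl_level U : compact U -> open U ->
  exists m, forall g, U g -> exists a b, gcyl_in U m a b /\ gcyl a b g.
Proof.
move=> /compact_near_coveringP cU /gopenP oU.
pose F : set_system 'N^k := filter_from setT (fun m => [set n | lek m n]).
have FF : Filter F.
  apply: filter_from_filter; first by exists 0%R.
  move=> m n _ _; exists (maxk m n) => // p /= mnp.
  by split; apply: lek_trans mnp; [exact: lek_maxl|exact: lek_maxr].
pose P m g := exists a b, gcyl_in U m a b /\ gcyl a b g.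
suff /(cU _ F P FF)[m _ mP] : forall g, U g -> \near g & F, P F g.
  by exists m => g; apply: mP; exact: lekk.
move=> g Ug; have [a [b [ab gab sU]]] := oU g Ug.
exists (gcyl a b, [set n | lek (kdeg a) n]).
  split; first by apply/gnbhsP; exists a, b; split.
  by exists (kdeg a).
move=> [h n] [] /= hab an.
have [e [ae dn he]] := gcyl_cut ab hab an.
exists (a ** e), (b ** e); split=> //; split=> //.
- by rewrite !ksource_comp// -ab.
- by exists h.
- exact: subset_trans (gcyl_sub ab ae) sU.
Qed.

Lemma compact_open_gcyl_partition U : row_finite L -> finitely_many_vertices L ->
  compact U -> open U -> set_inj U (@grange k L) ->
  exists n (a b : 'I_n -> L), [/\ forall i, ksource (a i) = ksource (b i),
    trivIset [set: 'I_n] (fun i => gcyl (a i) (b i)) &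
    U = \bigcup_(i in [set: 'I_n]) gcyl (a i) (b i)].
Proof.
move=> rf fv cU oU iU; have [m mU] := compact_gcyl_level cU oU.
have [n [a [ia Da]]] : exists n (a : 'I_n -> L),
    injective a /\ [set a | exists b, gcyl_in U m a b] = range a.
  apply: finite_set_enum; apply: sub_finite_set (klevel_finite m rf fv).
  by move=> a [b []].
have /choice[b ab] : forall i, exists b, gcyl_in U m (a i) b.
  move=> i; suff : [set a | exists b, gcyl_in U m a b] (a i) by [].
  by rewrite Da; exists i.
exists n, a, b; split=> [i||]; first by have [] := ab i.
  move=> i j _ _ [g [gi gj]]; apply: ia.
  have [di si _ _] := ab i; have [dj sj _ _] := ab j.
  by have [] := gcyl_label_inj si sj (etrans di (esym dj)) gi gj.
apply/seteqP; split=> [g /mU[c [d [cd gcd]]]|g [i _]]; last first.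
  by have [_ _ _] := ab i; apply.
have : [set a | exists b, gcyl_in U m a b] c by exists d.
by rewrite Da => -[i _ ci]; subst c; exists i; rewrite // (gcyl_in_inj iU (ab i) cd).
Qed.

Lemma bimap_id U : bisection U -> full U ->
  bimap U = id <-> forall g, U g -> grange g = gsource g.
Proof.
move=> bU fU; split=> [e g Ug|h]; first by rewrite -(bimapE bU Ug) e.
by apply/funext => y; have [g Ug <-] := full_source y fU; rewrite bimapE// h.
Qed.

End CylinderPartition.

Theorem lemma3p1 (k : nat) (hk : (0 < k)%N) (L : kgraph k)
    (rf : row_finite L) (sf : source_free L) (fv : finitely_many_vertices L) :
  gker (fg_pi rf fv) =
  [set U : full_group rf fv | exists (n : nat) (a b : 'I_n -> L),
    [/\ forall i, ksource (a i) = ksource (b i),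
        trivIset [set: 'I_n] (fun i => gcyl (a i) (b i)),
        fg_set U = \bigcup_(i in [set: 'I_n]) gcyl (a i) (b i) &
        forall i, path_equiv (a i) (b i)]].
Proof.
have kerE (U : full_group rf fv) : gker (fg_pi rf fv) U <->
    forall g, fg_set U g -> grange g = gsource g.
  apply: iff_trans (bimap_id (fg_bisection U) (fg_full U)).
  by split=> [/(congr1 (@tf_fun _ _ _ _))|e]; last exact: tf_eq.
apply/seteqP; split=> U; last first.
  move=> [n [a [b [_ _ UE ab]]]]; apply/kerE => g; rewrite UE => -[i _].
  by move=> [z az [-> _ ->]]; have [_] := ab i; apply.
move=> /kerE UK.
have [n [a [b [ab tab UE]]]] := compact_open_gcyl_partition rf fv
  (@fg_compact _ _ _ _ U) (@fg_open _ _ _ _ U) (fg_bisection U).1.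
exists n, a, b; split=> // i; split=> // x ax.
have [g gab [<- <-]] := gcyl_exists (ab i) (esym ax).
by apply: UK; rewrite UE; exists i.
Qed.
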